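(* Let $n\ge4$. Let $T_I$ be independent indeterminates indexed by the subsets $I\subseteq\{1,\ldots,n\}$ with $|I|\ge2$ (write $T_{1i}=T_{\{1,i\}}$, $T_{1ij}=T_{\{1,i,j\}}$, etc.), and for $2\le i<j\le n$ let $R_{ij}=R_{ji}$ be a square root of $T_{1ij}^2-4T_{1i}T_{1j}T_{ij}$ in an algebraic closure of $\mathbb{Q}(T_I:|I|\ge 2)$. For each choice of signs $\varepsilon=(\varepsilon_{ij})_{2\le i<j\le n}\in\{\pm1\}^{\binom{n-1}{2}}$, $\varepsilon_{ji}=\varepsilon_{ij}$, put $$E_\varepsilon=2^{n-2}\,T_{12}T_{13}\cdots T_{1n}\,T_{\{2,\ldots,n\}}-\frac12\sum_{\sigma}\ \prod_{i=2}^{n}\Bigl(T_{1\,i\,\sigma(i)}+(-1)^{\mathbf{1}_{i>\sigma(i)}}\varepsilon_{i\sigma(i)}R_{i\sigma(i)}\Bigr),$$ where the sum is over all $(n-1)$-cycles $\sigma$ on $\{2,\ldots,n\}$ (cyclic permutations with full support). Let $\mathfrak{N}_n$ be the product of all the distinct elements of the set $\{E_\varepsilon\}_\varepsilon$. Then $\mathfrak{N}_n$ is a polynomial in the indeterminates $T_I$, and it is a determinantal test of order $n$: if the $T_I$ are replaced by the cycle-sums of an arbitrary complex $n\times n$ matrix $A$, then $\mathfrak{N}_n$ vanishes.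
   Context: For a complex $n\times n$ matrix $A=(a_{ij})$ and $I\subseteq\{1,\ldots,n\}$ with $|I|=k\ge2$, the cycle-sum is $T_I(A)=\sum_\pi\prod_{i\in I}a_{i,\pi(i)}$, the sum over all $(k-1)!$ cyclic permutations $\pi$ ($k$-cycles) with support $I$. The cycle-sums are polynomials in the principal minors $A_J=\det[a_{ij}]_{i,j\in J}$: $$T_I=\sum_{I=I_1\sqcup\cdots\sqcup I_m}(-1)^{k+m}(m-1)!\,A_{I_1}\cdots A_{I_m}$$ (sum over all set partitions of $I$ into nonempty parts). A determinantal test of order $n$ is a polynomial in indeterminates $(A_J:J\subseteq\{1,\ldots,n\})$ (equivalently here, given through the $T_I$'s) which vanishes whenever the $A_J$ are the principal minors of some complex $n\times n$ matrix. *)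

(* Defs.v *)
From HB Require Import structures.
From mathcomp Require Import all_boot all_order all_fingroup all_algebra.
From mathcomp Require Import reals complex mpoly.

Set Implicit Arguments.
Unset Strict Implicit.
Unset Printing Implicit Defensive.

Import GRing.Theory.
Local Open Scope ring_scope.

(** The set {1, ..., n} is ['I_n], with [0 : 'I_n] playing the role of 1. *)

(** For [1 < #|I|], the second conjunct makes [s] move every point of [I] along
    a single orbit, so that [s] is a cyclic permutation with support [I]. *)
Definition cyclic_on (T : finType) (I : {set T}) (s : {perm T}) : bool :=
  perm_on I s && (I \in porbits s).

Definition cycle_sum (K : comNzRingType) (n : nat) (A : 'M[K]_n)
    (I : {set 'I_n}) : K :=
  \sum_(s : {perm 'I_n} | cyclic_on I s) \prod_(i in I) A i (s i).

Definition principal_minor (K : comNzRingType) (n : nat) (A : 'M[K]_n)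
    (J : {set 'I_n}) : K :=
  \det (\matrix_(i < #|J|, j < #|J|) A (enum_val i) (enum_val j)).

(** The polynomial rings Q[T_I : |I| >= 2] and Q[A_J : J]; the library indexes
    variables by ordinals, so the subsets are enumerated by [enum_rank]. *)
Definition big_subset (n : nat) : finType := {I : {set 'I_n} | (1 < #|I|)%N}.

Definition Tpoly (n : nat) := {mpoly rat[#|{: big_subset n}|]}.

Definition Apoly (n : nat) := {mpoly rat[#|{: {set 'I_n}}|]}.

(** T_I; the value 0 for [#|I| < 2] is never used. *)
Definition Tvar (n : nat) (I : {set 'I_n}) : Tpoly n :=
  if insub I is Some J then 'X_(enum_rank (J : big_subset n)) else 0.

Definition Avar (n : nat) (J : {set 'I_n}) : Apoly n := 'X_(enum_rank J).

Definition evalT (n : nat) (K : unitRingType) (t : {set 'I_n} -> K)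
    (P : Tpoly n) : K :=
  mmap ratr (fun k => t (val (enum_val k))) P.

Definition evalA (n : nat) (K : unitRingType) (a : {set 'I_n} -> K)
    (Q : Apoly n) : K :=
  mmap ratr (fun k => a (enum_val k)) Q.

Definition cycle_sum_in_minors (n : nat) (I : {set 'I_n}) : Apoly n :=
  \sum_(P : {set {set 'I_n}} | partition P I)
    (-1) ^+ (#|I| + #|P|) * ((#|P|.-1)`!)%:R * \prod_(B in P) Avar B.

(** A polynomial in the T_I rewritten as a polynomial in the A_J. *)
Definition in_minors (n : nat) (P : Tpoly n) : Apoly n :=
  P \mPo [tuple cycle_sum_in_minors (val (enum_val k)) | k < #|{: big_subset n}|].

Definition determinantal_test (R : realType) (n : nat) (Q : Apoly n) : Prop :=
  forall A : 'M[R[i]]_n, evalA (principal_minor A) Q = 0.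

Definition Tfrac (n : nat) := {fraction Tpoly n}.

Section NormProduct.

Variables (n : nat) (L : fieldType) (iota : Tfrac n -> L).
(** [o] stands for the index 1, so that {2, ..., n} is [~: [set o]]. *)
Variable o : 'I_n.

Definition TL (I : {set 'I_n}) : L := iota (tofrac (Tvar I)).

Definition is_root_family (R : 'I_n -> 'I_n -> L) : Prop :=
  forall i j : 'I_n, i != o -> j != o -> (i < j)%N ->
    R j i = R i j /\
    R i j ^+ 2 =
      TL [set o; i; j] ^+ 2 - 4%:R * TL [set o; i] * TL [set o; j] * TL [set i; j].

(** [e (i, j) = true] encodes the sign -1. Only the entries at distinct
    [i], [j] different from [o] matter, so distinct [e] may encode the same
    choice of signs. *)
Definition sign_choice (e : {ffun 'I_n * 'I_n -> bool}) : bool :=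
  [forall i, forall j, e (j, i) == e (i, j)].

Definition Eeps (R : 'I_n -> 'I_n -> L) (e : {ffun 'I_n * 'I_n -> bool}) : L :=
  2%:R ^+ (n - 2) * (\prod_(i | i != o) TL [set o; i]) * TL (~: [set o])
  - 2%:R^-1 *
    \sum_(s : {perm 'I_n} | cyclic_on (~: [set o]) s)
      \prod_(i | i != o)
        (TL [set o; i; s i]
         + (-1) ^+ (s i < i)%N * (-1) ^+ e (i, s i) * R i (s i)).

Definition normN (R : 'I_n -> 'I_n -> L) : L :=
  \prod_(x <- undup [seq Eeps R e | e <- enum sign_choice]) x.

End NormProduct.

Definition first_index (n : nat) (n_ge4 : (4 <= n)%N) : 'I_n :=
  Ordinal (leq_trans (isT : (0 < 4)%N) n_ge4).

(* Main.v *)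
Require Import Defs.
From HB Require Import structures.
From mathcomp Require Import all_boot all_order all_fingroup all_algebra.
From mathcomp Require Import reals complex mpoly.
From mathcomp Require Import fraction generic_quotient ring.

Set Implicit Arguments.
Unset Strict Implicit.
Unset Printing Implicit Defensive.

Import GRing.Theory Num.Theory.
Local Open Scope ring_scope.

(** The product of the distinct E_eps descends to a polynomial by Galois theory
    done by hand: each discriminant T_1ij^2 - 4 T_1i T_1j T_ij is the only one to
    involve T_ij, and has degree 1 in it, so no product of distinct discriminants
    is a square and the tower of quadratic extensions generated by the R_ij has
    full degree.  Hence an equality E_eps = E_eps' survives any change of signs
    of the R_ij: the product of the distinct E_eps is invariant under these
    changes, so it equals its average over them, which only involves even powers
    of the R_ij; moreover all the values E_eps are taken equally often, so that the
    product of all the E_eps is a power of the product of the distinct ones.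
    The former vanishes at the cycle-sums of A, because the choice
    R_ij = a_1i a_ij a_j1 - a_1j a_ji a_i1 makes one E_eps vanish.

    For the expression of the cycle-sums in the principal minors, the product of
    the minors A_B over the blocks B of a partition is a sum over the permutations
    that stabilise all the blocks.  The weights (-1)^m (m-1)! of the partitions
    stable under a given permutation add up to 0 unless it is a cycle: gluing one
    of its orbits to a block of a partition of the rest, or leaving it alone,
    gives terms that cancel. *)

(** * Towers of quadratic extensions *)

Section QuadraticTower.

Variables (K L : fieldType) (iota : {rmorphism K -> L}).

Definition in_base (x : L) : Prop := exists a, x = iota a.

(** When the squares of the entries of [rs] lie in [K], this is the field they generate over [K],
    built by one quadratic step per entry; the representation [a + b * r] may fail to be unique. *)
Fixpoint in_adj (rs : seq L) (x : L) : Prop :=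
  if rs is r :: rs' then
    exists a b, [/\ in_adj rs' a, in_adj rs' b & x = a + b * r]
  else in_base x.

Lemma in_adj_base rs a : in_adj rs (iota a).
Proof.
elim: rs a => [|r rs IH] a /=; first by exists a.
by exists (iota a), (iota 0); split=> //; rewrite rmorph0 mul0r addr0.
Qed.

Lemma in_adj0 rs : in_adj rs 0.
Proof. by rewrite -(rmorph0 iota); apply: in_adj_base. Qed.

Lemma in_adj1 rs : in_adj rs 1.
Proof. by rewrite -(rmorph1 iota); apply: in_adj_base. Qed.

Lemma in_adj_mem rs r : r \in rs -> in_adj rs r.
Proof.
elim: rs => //= r' rs IH; rewrite inE => /predU1P [->|/IH rs_r].
  by exists 0, 1; split; [exact: in_adj0|exact: in_adj1|rewrite add0r mul1r].
by exists r, 0; split=> //; [exact: in_adj0|rewrite mul0r addr0].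
Qed.

Lemma in_adjD rs x y : in_adj rs x -> in_adj rs y -> in_adj rs (x + y).
Proof.
elim: rs x y => [|r rs IH] x y /=.
  by move=> [a ->] [b ->]; exists (a + b); rewrite rmorphD.
move=> [a [b [ha hb ->]]] [c [d [hc hd ->]]].
by exists (a + c), (b + d); split; [exact: IH|exact: IH|ring].
Qed.

Lemma in_adjN rs x : in_adj rs x -> in_adj rs (- x).
Proof.
elim: rs x => [|r rs IH] x /=; first by move=> [a ->]; exists (- a); rewrite rmorphN.
by move=> [a [b [ha hb ->]]]; exists (- a), (- b); split; [exact: IH|exact: IH|ring].
Qed.

Definition all_squares_in (rs : seq L) := forall r, r \in rs -> in_base (r ^+ 2).

Lemma in_adjM rs x y :
  all_squares_in rs -> in_adj rs x -> in_adj rs y -> in_adj rs (x * y).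
Proof.
elim: rs x y => [|r rs IH] x y sq /=.
  by move=> [a ->] [b ->]; exists (a * b); rewrite rmorphM.
have sq' : all_squares_in rs by move=> z hz; apply: sq; rewrite inE hz orbT.
have [s sE] := sq r (mem_head r rs).
move=> [a [b [ha hb ->]]] [c [d [hc hd ->]]].
exists (a * c + b * d * iota s), (a * d + b * c); rewrite -sE; split; last by ring.
  apply: in_adjD; first exact: IH.
  apply: (IH) => //; first exact: IH.
  by rewrite sE; apply: in_adj_base.
by apply: in_adjD; apply: IH.
Qed.

(** The denominator is cleared with the conjugate [a - b * r]: its product with [a + b * r] lies in
    the field below because [r ^+ 2] does. *)
Lemma in_adjV rs x : 2%:R != 0 :> L ->
  all_squares_in rs -> in_adj rs x -> in_adj rs x^-1.
Proof.
move=> two; elim: rs x => [|r rs IH] x sq /=.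
  by move=> [a ->]; exists a^-1; rewrite fmorphV.
have sq' : all_squares_in rs by move=> z hz; apply: sq; rewrite inE hz orbT.
have [s sE] := sq r (mem_head r rs).
move=> [a [b [ha hb ->]]].
have hs : in_adj rs (r ^+ 2) by rewrite sE; apply: in_adj_base.
have [->|nz0] := eqVneq (a + b * r) 0.
  by rewrite invr0; exists 0, 0; split; [exact: in_adj0|exact: in_adj0|ring].
(* The conjugate can vanish if [r] already lies in the field below; then [b * r = a] and the element
   is [2 a]. *)
have [conj0|nzc] := eqVneq (a - b * r) 0.
  have -> : a + b * r = 2%:R * a by move/subr0_eq: conj0 => <-; ring.
  exists (2%:R * a)^-1, 0; split; last by ring.
    apply: IH => //; apply: in_adjM => //.
    by rewrite -(rmorph_nat iota); apply: in_adj_base.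
  exact: in_adj0.
have nrm : in_adj rs ((a + b * r) * (a - b * r))^-1.
  apply: IH => //.
  have -> : (a + b * r) * (a - b * r) = a * a - b * b * r ^+ 2 by ring.
  apply: in_adjD; first exact: in_adjM.
  by apply/in_adjN/in_adjM => //; apply: in_adjM.
exists (a * ((a + b * r) * (a - b * r))^-1),
       (- b * ((a + b * r) * (a - b * r))^-1); split.
- exact: in_adjM.
- by apply: in_adjM => //; apply: in_adjN.
- by field; rewrite nz0 nzc.
Qed.

(** Induction on [rs], for all [r]. A relation [r = a + b * r'] over the field of [rs] puts
    [r * r'], [r] or [r'] in that field, according to whether [a], [b] or neither vanishes; the
    induction hypothesis excludes all three. *)
Lemma sqrt_notin_adj rs r : 2%:R != 0 :> L -> all_squares_in (r :: rs) ->
  (forall m, mask m (r :: rs) != [::] -> ~ in_base (\prod_(x <- mask m (r :: rs)) x)) ->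
  ~ in_adj rs r.
Proof.
move=> two; elim: rs r => [|r' rs IH] r sq indep.
  by have := indep [:: true] isT; rewrite /= big_seq1.
have sqr : in_base (r ^+ 2) by apply: sq; rewrite mem_head.
have sqr' : in_base (r' ^+ 2) by apply: sq; rewrite !inE eqxx orbT.
have sqrs : all_squares_in rs by move=> z hz; apply: sq; rewrite !inE hz !orbT.
have sq1 (z : L) : in_base (z ^+ 2) -> all_squares_in (z :: rs).
  by move=> hz y; rewrite inE => /predU1P [->|/sqrs].
have nr : ~ in_adj rs r.
  apply: IH; first exact: sq1.
  (* A mask on [r :: rs] extends to one on [r :: r' :: rs] that skips [r']. *)
  by case=> [|[] m]; [|have := indep (true :: false :: m)|have := indep (false :: false :: m)].
have nr' : ~ in_adj rs r'.
  apply: IH; first exact: sq1.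
  by move=> m; have := indep (false :: m).
(* the third quadratic subfield, generated by [r * r'] *)
have nrr' : ~ in_adj rs (r * r').
  apply: IH.
    apply: sq1; rewrite exprMn; case: sqr sqr' => [a ->] [b ->].
    by exists (a * b); rewrite rmorphM.
  case=> [|[] m]; first by [].
    by have := indep (true :: true :: m); rewrite /= !big_cons mulrA.
  by have := indep (false :: false :: m).
move=> /= [a [b [ha hb rE]]].
have hr2 : in_adj rs (r ^+ 2) by case: sqr => s ->; apply: in_adj_base.
have hr'2 : in_adj rs (r' ^+ 2) by case: sqr' => s ->; apply: in_adj_base.
have [a0|nza] := eqVneq a 0.
  apply: nrr'; rewrite rE a0 add0r -mulrA -expr2.
  exact: in_adjM.
have [b0|nzb] := eqVneq b 0; first by apply: nr; rewrite rE b0 mul0r addr0.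
apply: nr'.
(* Squaring [r = a + b * r'] gives the cross term [2 a b r'], which is solved for [r']. *)
have -> : r' = (r ^+ 2 - a * a - b * b * r' ^+ 2) * (2%:R * a * b)^-1.
  by rewrite rE; field; rewrite nza nzb two.
have h2 : in_adj rs 2%:R by rewrite -(rmorph_nat iota); apply: in_adj_base.
apply: in_adjM => //; last by apply: in_adjV => //; do !apply: in_adjM => //.
do ![apply: in_adjD => //]; apply: in_adjN; do ![apply: in_adjM => //].
Qed.

End QuadraticTower.

(** * Sign changes of square roots *)

Section SignAction.

Variables (Q : finType) (A : comNzRingType).

Notation signs := {ffun Q -> bool}.

Definition flip (B : pzRingType) (e : signs) (y : Q -> B) (q : Q) : B :=
  (-1) ^+ e q * y q.

Definition sign_add (e d : signs) : signs := [ffun q => e q (+) d q].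

Lemma sign_addK d : involutive (sign_add^~ d).
Proof. by move=> e; apply/ffunP=> q; rewrite !ffunE addbK. Qed.

Definition eval_at (B : comNzRingType) (g : {rmorphism A -> B}) (y : Q -> B)
    (p : {mpoly A[#|Q|]}) : B :=
  mmap g (fun k => y (enum_val k)) p.

HB.instance Definition _ (B : comNzRingType) (g : {rmorphism A -> B}) (y : Q -> B) :=
  GRing.RMorphism.copy (eval_at g y) (mmap g (fun k => y (enum_val k))).

Lemma eval_atC (B : comNzRingType) (g : {rmorphism A -> B}) (y : Q -> B) c :
  eval_at g y c%:MP = g c.
Proof. exact: mmapC. Qed.

Lemma eval_atX (B : comNzRingType) (g : {rmorphism A -> B}) (y : Q -> B) q :
  eval_at g y 'X_(enum_rank q) = y q.
Proof. by rewrite /eval_at mmapX mmap1U enum_rankK. Qed.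

(** The sign change acts here on formal roots, before any values are chosen for them. *)
Definition shift (e : signs) : {mpoly A[#|Q|]} -> {mpoly A[#|Q|]} :=
  eval_at (@mpolyC _ A) (flip e (fun q => 'X_(enum_rank q))).

Lemma eval_at_shift (B : comNzRingType) (g : {rmorphism A -> B}) (y : Q -> B)
    (e d : signs) p :
  eval_at g (flip d y) (shift e p) = eval_at g (flip (sign_add e d) y) p.
Proof.
rewrite /shift {2}/eval_at /mmap rmorph_sum; apply: eq_bigr => m _ /=.
rewrite rmorphM. rewrite /= eval_atC /mmap1 rmorph_prod; congr (_ * _).
apply: eq_bigr => k _; rewrite rmorphXn; congr (_ ^+ _).
by rewrite /flip rmorphM rmorph_sign /= eval_atX ffunE mulrA signr_addb.
Qed.

Variables (D : Q -> A) (half : A).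

(* Averaging over all sign changes of the square roots kills the odd powers
   and turns the even ones into powers of [D]. *)
Definition average (p : {mpoly A[#|Q|]}) : A :=
  half ^+ #|Q| * \sum_(m <- msupp p) p@_m *
    \prod_(q : Q) (if odd (m (enum_rank q)) then 0
                   else 2%:R * D q ^+ (m (enum_rank q))./2).

(** On a monomial the sum over all signs factors over [q] into sums of two terms, which cancel for
    an odd exponent and coincide for an even one. *)
Lemma average_eq (B : comNzRingType) (g : {rmorphism A -> B}) (y : Q -> B) p :
  (forall q, y q ^+ 2 = g (D q)) ->
  g (average p) = g half ^+ #|Q| * \sum_(e : signs) eval_at g (flip e y) p.
Proof.
move=> yD; rewrite /average rmorphM rmorphXn; congr (_ * _).
rewrite rmorph_sum exchange_big; apply: eq_bigr => m _ /=.
rewrite rmorphM rmorph_prod -mulr_sumr; congr (_ * _).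
transitivity (\sum_(e : signs) \prod_q ((-1) ^+ e q * y q) ^+ m (enum_rank q)).
  rewrite -(bigA_distr_bigA (fun q (b : bool) => ((-1) ^+ b * y q) ^+ m (enum_rank q))) /=.
  apply: eq_bigr => q _; rewrite big_bool !mulr_sign /=.
  rewrite exprNn -signr_odd; set k := m _.
  case: ifP => odd_k; first by rewrite mulN1r addNr rmorph0.
  rewrite mul1r rmorphM rmorphXn rmorph_nat -yD -exprM mul2n.
  by rewrite even_halfK ?odd_k // mulr_natl mulr2n.
apply: eq_bigr => e _; rewrite /mmap1.
rewrite (reindex_onto enum_val enum_rank) => [|q _]; last exact: enum_rankK.
by apply: eq_big => k; rewrite ?enum_valK ?eqxx.
Qed.

End SignAction.

(** * Descent of the product of the distinct values to the base ring *)

Lemma fraction_numden (A : idomainType) (c : {fraction A}) :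
  exists a b : A, b != 0 /\ c * tofrac b = tofrac a.
Proof.
elim/quotW: c => x; exists \n_x, \d_x; split; first exact: denom_ratioP.
unlock FracField.tofrac; rewrite -[LHS]FracField.pi_mul.
apply/eqmodP; rewrite /= FracField.equivfE /FracField.mulf.
by rewrite !numden_Ratio ?mulf_neq0 ?oner_neq0 ?denom_ratioP // !mulr1 mulrC.
Qed.

Section NormProduct.

Variables (Q : finType) (A : idomainType) (L : fieldType).
Variables (iota : {rmorphism {fraction A} -> L}) (D : Q -> A) (half : A).
Hypothesis halfE : 2%:R * half = 1.
(** That is, no nonempty product of distinct [D q] is a square in the fraction field, with the
    denominator [b] cleared. *)
Hypothesis indep : forall (S : {set Q}) (a b : A), S != set0 -> b != 0 ->
  b ^+ 2 * \prod_(q in S) D q != a ^+ 2.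

Notation signs := {ffun Q -> bool}.

Let phi : {rmorphism A -> L} := iota \o (@tofrac A).

Variables (r : Q -> L) (p : {mpoly A[#|Q|]}).
Hypothesis rD : forall q, r q ^+ 2 = phi (D q).

Let E (e : signs) : L := eval_at phi (flip e r) p.

Let two_neq0 : 2%:R != 0 :> L.
Proof.
apply/eqP => two0; have /eqP := congr1 phi halfE.
by rewrite rmorphM rmorph_nat two0 mul0r rmorph1 eq_sym oner_eq0.
Qed.

Let others (q : Q) : seq L := [seq r x | x <- enum (predC1 q)].

(** If a product of distinct roots lay in the fraction field, its square would make a product of the
    [D q] the square of a fraction, against [indep]. *)
Lemma sqrt_notin_others q : ~ in_adj iota (others q) (r q).
Proof.
have sq x : in_base iota (r x ^+ 2) by rewrite rD; exists (tofrac (D x)).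
rewrite /others; apply: sqrt_notin_adj => //.
  by move=> z; rewrite inE => /predU1P [->|/mapP [x _ ->]].
rewrite -map_cons => m; rewrite -map_mask; set s := mask m _ => nz [c].
have us : uniq s by rewrite mask_uniq //= mem_enum inE eqxx enum_uniq.
rewrite big_map (big_uniq _ us) => cE.
move/(congr1 (fun x => x ^+ 2)): cE.
have [a [b [nzb cb]]] := fraction_numden c.
rewrite -prodrXl (eq_bigr (phi \o D)) => [|x _]; last by rewrite rD.
rewrite -rmorph_prod -rmorphXn => /fmorph_inj cD.
have : tofrac (b ^+ 2 * \prod_(x in s) D x) = tofrac (a ^+ 2).
  by rewrite rmorphM !rmorphXn /= cD -cb exprMn mulrC.
move/eqP; rewrite tofrac_eq.
have -> : \prod_(x in s) D x = \prod_(x in [set x in s]) D x.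
  by apply: eq_bigl => x; rewrite inE.
apply/negP/indep => //; rewrite -cards_eq0 cardsE; move/card_uniqP: us => ->.
by rewrite size_eq0; apply: contraNneq nz => ->.
Qed.


(** The graph of the automorphism that negates [r q] and fixes the field of the other roots, handled
    as a relation. *)
Let conjugate (q : Q) (u v : L) := exists G H,
  [/\ in_adj iota (others q) G, in_adj iota (others q) H,
      u = G + H * r q & v = G - H * r q].

Let others_sq q : all_squares_in iota (others q).
Proof. by move=> z /mapP [x _ ->]; exists (tofrac (D x)); rewrite rD. Qed.

Let conjugate_base q a : conjugate q (phi a) (phi a).
Proof.
exists (phi a), 0; split; [exact: in_adj_base|exact: in_adj0|ring|ring].
Qed.

Let conjugateD q u v u' v' :
  conjugate q u v -> conjugate q u' v' -> conjugate q (u + u') (v + v').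
Proof.
move=> [G [H [hG hH -> ->]]] [G' [H' [hG' hH' -> ->]]].
by exists (G + G'), (H + H'); split; [exact: in_adjD|exact: in_adjD|ring|ring].
Qed.

Let conjugateM q u v u' v' :
  conjugate q u v -> conjugate q u' v' -> conjugate q (u * u') (v * v').
Proof.
move=> [G [H [hG hH -> ->]]] [G' [H' [hG' hH' -> ->]]].
have sq := @others_sq q; exists (G * G' + H * H' * r q ^+ 2), (G * H' + H * G').
split; [| |ring|ring]; apply: in_adjD; do ?exact: in_adjM.
apply: in_adjM => //; first exact: in_adjM.
by rewrite rD; apply: in_adj_base.
Qed.

Let flip_one (q : Q) (e : signs) : signs := sign_add e [ffun x => x == q].

(** Conjugation respects sums and products, so only coefficients and signed roots need checking: it
    fixes the former, and among the latter it negates that of [q] alone. *)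
Lemma conjugate_eval q e : conjugate q (E e) (E (flip_one q e)).
Proof.
have c0 : conjugate q 0 0 by have := conjugate_base q 0; rewrite rmorph0.
have c1 : conjugate q 1 1 by have := conjugate_base q 1; rewrite rmorph1.
apply: (big_ind2 (conjugate q)) => // [x1 x2 y1 y2|m _]; first exact: conjugateD.
apply: conjugateM; first exact: conjugate_base.
apply: (big_ind2 (conjugate q)) => // [x1 x2 y1 y2|k _]; first exact: conjugateM.
elim: (m k) => [|j IH]; first by rewrite !expr0.
rewrite !exprS; apply: conjugateM => //; rewrite /flip !ffunE.
set x := enum_val k; have [->|neq] := eqVneq x q.
  exists 0, ((-1) ^+ e q); split; [exact: in_adj0| |ring|].
    by have := in_adj_base iota (others q) ((-1) ^+ e q); rewrite rmorph_sign.
  by rewrite signr_addb expr1; ring.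
rewrite addbF; exists ((-1) ^+ e x * r x), 0; split; [|exact: in_adj0|ring|ring].
apply: in_adjM; first exact: others_sq.
  by have := in_adj_base iota (others q) ((-1) ^+ e x); rewrite rmorph_sign.
by apply/in_adj_mem/map_f; rewrite mem_enum inE.
Qed.

(** If [G + H * r q = G' + H' * r q] with [H] and [H'] distinct, then [r q] would lie in the field
    of the other roots. So the coefficients agree, and with them the conjugates. *)
Lemma eval_flip_one q e e' : E e = E e' -> E (flip_one q e) = E (flip_one q e').
Proof.
have [G [H [hG hH -> ->]]] := conjugate_eval q e.
have [G' [H' [hG' hH' -> ->]]] := conjugate_eval q e' => eqE.
have [eqH|neqH] := eqVneq H H'.
  by move: eqE; rewrite eqH => /addIr ->.
have sq := @others_sq q; case: (@sqrt_notin_others q).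
have nz : H - H' != 0 by rewrite subr_eq0.
have -> : r q = (G' - G) * (H - H')^-1.
  apply: (mulIf nz); rewrite mulfVK // mulrBr ![r q * _]mulrC.
  by apply/eqP; rewrite subr_eq addrAC eq_sym subr_eq -eqE addrC.
by apply: in_adjM => //; [|apply: in_adjV => //]; apply: in_adjD => //; apply: in_adjN.
Qed.

(** A sign change is a succession of changes of single roots; [d_ s] carries out those of [d] at the
    roots listed in [s]. *)
Lemma eval_sign_add e e' d :
  E e = E e' -> E (sign_add e d) = E (sign_add e' d).
Proof.
pose d_ (s : seq Q) : signs := [ffun q => (q \in s) && d q].
suff H (s : seq Q) : E e = E e' -> E (sign_add e (d_ s)) = E (sign_add e' (d_ s)).
  by move/(H (enum Q)); congr (E (sign_add _ _) = E (sign_add _ _));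
     apply/ffunP => q; rewrite ffunE mem_enum.
elim: s => [|q s IH] eqE.
  by suff d0 e0 : sign_add e0 (d_ [::]) = e0; [rewrite !d0|
    apply/ffunP => x; rewrite !ffunE addbF].
have [qs|] := boolP ((q \in s) || ~~ d q).
  suff -> : d_ (q :: s) = d_ s by exact: IH.
  apply/ffunP => x; rewrite !ffunE inE; case: eqP => //= ->.
  by case: (q \in s) qs => //= /negbTE ->.
rewrite negb_or negbK => /andP [nqs dq].
have dE e0 : sign_add e0 (d_ (q :: s)) = flip_one q (sign_add e0 (d_ s)).
  apply/ffunP => x; rewrite !ffunE inE; case: eqP => [->|_] /=.
    by rewrite (negbTE nqs) dq addbF.
  by rewrite addbF.
by rewrite !dE; apply/eval_flip_one/IH.
Qed.

Lemma eval_sign_addE e e' d :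
  (E (sign_add e d) == E (sign_add e' d)) = (E e == E e').
Proof.
apply/eqP/eqP => [|/eval_sign_add //].
by move/(@eval_sign_add _ _ d); rewrite !sign_addK.
Qed.

Let values := undup [seq E e | e <- enum {: signs}].

(** The average runs over [2 ^ #|Q|] equal terms, and the power of [half] cancels their number. *)
Let average_prod (B : comNzRingType) (g : {rmorphism A -> B}) (y : Q -> B) (s : seq signs) c :
  (forall q, y q ^+ 2 = g (D q)) ->
  (forall d, \prod_(e <- s) eval_at g (flip (sign_add e d) y) p = c) ->
  g (average D half (\prod_(e <- s) shift e p)) = c.
Proof.
move=> yD sc; rewrite (average_eq _ _ yD).
rewrite (eq_bigr (fun=> c)) => [|d _]; last first.
  by rewrite rmorph_prod -(sc d); apply: eq_bigr => e _; apply: eval_at_shift.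
rewrite sumr_const card_ffun card_bool -mulr_natl natrX mulrA -exprMn mulrC.
by rewrite -(rmorph_nat g) -rmorphM [half * _]mulrC halfE rmorph1 expr1n mulr1.
Qed.

(** One sign choice [rep x] is fixed for each value [x]. Changing signs by [d] permutes the distinct
    values, so the product over the representatives is invariant and equals its average, which comes
    from [A]. *)
Lemma prod_values_descends : exists P : A, phi P = \prod_(x <- values) x.
Proof.
pose rep x : signs := odflt [ffun=> false] [pick e | E e == x].
have repK x : x \in values -> E (rep x) = x.
  rewrite mem_undup => /mapP [e _ ->]; rewrite /rep.
  by case: pickP => [e' /eqP //|/(_ e)]; rewrite eqxx.
exists (average D half (\prod_(e <- [seq rep x | x <- values]) shift e p)).
apply: average_prod => // d.
rewrite big_map -[LHS](big_map (fun x => E (sign_add (rep x) d)) xpredT id).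
have uniq_shifted : uniq [seq E (sign_add (rep x) d) | x <- values].
  rewrite map_inj_in_uniq ?undup_uniq // => x x' vx vx' /eqP.
  by rewrite eval_sign_addE !repK // => /eqP.
apply: perm_big; apply: uniq_perm; rewrite ?undup_uniq //.
(* The shifted values are distinct, are among [values] and are as many, so they exhaust [values]. *)
apply: (uniq_min_size _ _ _).2; rewrite ?size_map // => z /mapP [x _ ->].
by rewrite mem_undup map_f // mem_enum.
Qed.

(** Translation by [d] carries the sign choices with value [E e0] bijectively to those with value
    [E d], so every value is taken the same number [M] of times. *)
Lemma prod_eval_expr : exists M, \prod_(e : signs) E e = (\prod_(x <- values) x) ^+ M.
Proof.
pose e0 : signs := [ffun=> false].
exists (\sum_(e : signs) (E e == E e0))%N.
rewrite -big_enum -(big_map E xpredT id) -big_undup_iterop_count /=.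
rewrite -prodrXl; apply: eq_big_seq => x; rewrite mem_undup => /mapP [d _ ->].
congr iterop.
rewrite count_map -sum1_count big_enum_cond big_mkcond /=.
rewrite (reindex_inj (can_inj (sign_addK d))) /=; apply: eq_bigr => e _.
have -> : E d = E (sign_add e0 d) by congr E; apply/ffunP => q; rewrite !ffunE.
by rewrite eval_sign_addE; case: (E e == E e0).
Qed.

(** In [K] distinct values may merge and a set of representatives may miss the vanishing one. Hence
    the detour through [F], the product over all sign choices: it equals [P ^+ M] already in [A], by
    injectivity into [L], and its image in [K] has a zero factor. *)
Lemma norm_product_descends :
  exists P : A, phi P = \prod_(x <- values) x /\
    forall (K : idomainType) (g : {rmorphism A -> K}) (y : Q -> K) (e : signs),
      (forall q, y q ^+ 2 = g (D q)) ->
      eval_at g (flip e y) p = 0 -> g P = 0.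
Proof.
have [P PE] := prod_values_descends; exists P; split=> // K g y e1 yD e1_0.
have [M ME] := prod_eval_expr.
pose F := average D half (\prod_(e <- enum {: signs}) shift e p).
have FE (B : comNzRingType) (h : {rmorphism A -> B}) (z : Q -> B) :
    (forall q, z q ^+ 2 = h (D q)) ->
    h F = \prod_(e : signs) eval_at h (flip e z) p.
  move=> zD; apply: (average_prod zD) => d.
  by rewrite big_enum [RHS](reindex_inj (can_inj (sign_addK d))).
have FP : F = P ^+ M.
  apply/eqP; rewrite -tofrac_eq; apply/eqP/(fmorph_inj iota).
  by rewrite rmorphXn rmorphXn -[iota _]/(phi F) -[iota (tofrac P)]/(phi P) (FE _ phi r) // ME PE.
have : g P ^+ M == 0.
  by rewrite -rmorphXn -FP (FE _ _ y yD) (bigD1 e1) //= e1_0 mul0r.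
by rewrite expf_eq0 => /andP [_ /eqP].
Qed.

End NormProduct.

(** * Partitions stable under a permutation *)

Section StablePartitions.

Variables (T : finType) (s : {perm T}).

Definition stable_blocks (P : {set {set T}}) : bool :=
  [forall B in P, forall y in B, s y \in B].

Lemma stable_blocksP (P : {set {set T}}) :
  reflect (forall B y, B \in P -> y \in B -> s y \in B) (stable_blocks P).
Proof.
apply: (iffP forall_inP) => [H B y /H /forall_inP|H B PB]; first exact.
by apply/forall_inP => y; apply: H.
Qed.

Lemma mem_porbit_step x y : (s y \in porbit s x) = (y \in porbit s x).
Proof. by rewrite -!eq_porbit_mem -[s y]/((s ^+ 1)%g y) porbit_perm. Qed.

Lemma porbit_sub_stable (B : {set T}) x :
  (forall y, y \in B -> s y \in B) -> x \in B -> porbit s x \subset B.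
Proof.
move=> sB xB; apply/subsetP => _ /porbitP [i ->].
by elim: i => [|i IH]; rewrite ?perm1 // expgSr permM sB.
Qed.

Definition partition_weight (R : pzRingType) (m : nat) : R :=
  (-1) ^+ m * (m.-1)`!%:R.

(** This is the cancellation behind the gluing argument: one term for the orbit as a new block, [m]
    terms for gluing it to one of [m] blocks. *)
Lemma partition_weightS (R : comPzRingType) m : (0 < m)%N ->
  partition_weight R m.+1 + m%:R * partition_weight R m = 0.
Proof.
by case: m => // m _; rewrite /partition_weight /= factS natrM exprS; ring.
Qed.

Variables (I : {set T}) (x : T).
Hypotheses (sI : perm_on I s) (xI : x \in I).

Let O := porbit s x.
Let J := I :\: O.

Let OI : O \subset I.
Proof. by apply: porbit_sub_stable => // y yI; rewrite perm_closed. Qed.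

Let xO : x \in O := porbit_id s x.

Definition is_stable_partition (D : {set T}) P := partition P D && stable_blocks P.

(** The block of [x] is closed under [s], so it contains the orbit of [x], which is all of [I]. *)
Lemma stable_partition_of_cycle (P : {set {set T}}) :
  O = I -> is_stable_partition I P = (P == [set I]).
Proof.
move=> OE; apply/andP/eqP => [[PI /stable_blocksP st]|->].
  have tP := partition_trivIset PI.
  have xP : x \in cover P by rewrite (cover_partition PI).
  have bP := pblock_mem xP.
  have bI : pblock P x = I.
    apply/eqP; rewrite eqEsubset (partitionS PI bP) -OE.
    by apply: porbit_sub_stable => [y|]; [apply: st|rewrite mem_pblock].
  apply/setP => C; rewrite inE; apply/idP/eqP => [PC|->]; last by rewrite -bI.
  have /set0Pn [y yC] := partition_neq0 PI PC.
  rewrite -bI -(def_pblock tP PC yC); apply: same_pblock => //.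
  by rewrite bI; apply: (subsetP (partitionS PI PC)).
split; last first.
  by apply/stable_blocksP => B y; rewrite inE => /eqP ->; rewrite perm_closed.
rewrite /partition cover1 eqxx trivIset1 inE /= eq_sym.
by apply/set0Pn; exists x.
Qed.

(* A stable partition of [I] amounts to one of [J] together with the block
   that absorbs the orbit [O], where [set0] stands for a new block. *)
Let glue (w : {set {set T}} * {set T}) : {set {set T}} :=
  (O :|: w.2) |: (w.1 :\ w.2).

(** If [O] is a block by itself, [B :\: O] is empty: it is then removed from the partition of [J]
    but kept as the mark of a new block. *)
Let unglue (P : {set {set T}}) : {set {set T}} * {set T} :=
  let B := pblock P x in (((B :\: O) |: (P :\ B)) :\ set0, B :\: O).

Let glueable (w : {set {set T}} * {set T}) : bool :=
  is_stable_partition J w.1 && (w.2 \in set0 |: w.1).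

Let O_notin_J (B : {set T}) : B \subset J -> x \notin B.
Proof. by move/subsetP=> BJ; apply/negP => /BJ; rewrite inE xO. Qed.

Let w2J w : glueable w -> w.2 \subset J.
Proof.
move=> /andP [/andP [PJ _]]; rewrite !inE => /predU1P [->|/(partitionS PJ) //].
exact: sub0set.
Qed.

Let rest_notin w : glueable w -> O :|: w.2 \notin w.1 :\ w.2.
Proof.
move=> /andP [/andP [PJ _] _]; apply/negP => /setD1P [_ /(partitionS PJ)].
by move/O_notin_J; rewrite inE xO.
Qed.

Let setD1_notin (P : {set {set T}}) B : B \notin P -> P :\ B = P.
Proof. by move=> nPB; apply/setDidPl; rewrite disjoint_sym disjoints1. Qed.

Let glue_stable w : glueable w -> is_stable_partition I (glue w).
Proof.
move=> gw; have wJ := w2J gw; case/andP: gw => /andP [PJ /stable_blocksP st] w2.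
have rest : partition (w.1 :\ w.2) (J :\: w.2).
  case/setU1P: (w2) => [->|w2']; last exact: partitionD1.
  by rewrite setD0 setD1_notin // (partition0 PJ).
have IE : I = (O :|: w.2) :|: (J :\: w.2).
  apply/setP => y; have /implyP := subsetP OI y; have /implyP := subsetP wJ y.
  by rewrite !inE; case: (y \in O); case: (y \in w.2); case: (y \in I).
apply/andP; split.
  rewrite /glue IE; apply: partitionU1 rest _ _.
    by apply/set0Pn; exists x; rewrite inE xO.
  rewrite disjoint_sym disjoints_subset; apply/subsetP => y; rewrite !inE.
  by case: (y \in O); rewrite ?andbF //= andbC => /andP [].
apply/stable_blocksP => B y /setU1P [->|/setD1P [_ PB]]; last exact: st.
rewrite !inE => /orP [yO|yw]; first by rewrite mem_porbit_step yO.
case/setU1P: (w2) => [w0|w2']; first by rewrite w0 inE in yw.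
by rewrite (st _ _ w2' yw) orbT.
Qed.

Let glueK w : glueable w -> unglue (glue w) = w.
Proof.
move=> gw; have /andP [gI _] := glue_stable gw; have wJ := w2J gw.
have nrest := rest_notin gw.
have xB : pblock (glue w) x = O :|: w.2.
  apply: def_pblock; first exact: partition_trivIset gI.
    by rewrite !inE eqxx.
  by rewrite inE xO.
have wO : (O :|: w.2) :\: O = w.2.
  rewrite setDUl setDv set0U; apply/setDidPl.
  by move: wJ; rewrite subsetD => /andP [].
rewrite /unglue xB /glue wO setU1K // [RHS]surjective_pairing; congr pair.
case/andP: gw => /andP [PJ _]; have n0 : set0 \notin w.1 by rewrite (partition0 PJ).
move=> /setU1P [->|w2]; first by rewrite setU1K // ?inE ?eqxx // setD1_notin.
by rewrite setD1K // setD1_notin.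
Qed.

Let unglueK P : is_stable_partition I P -> glue (unglue P) = P.
Proof.
move=> /andP [PI /stable_blocksP st]; rewrite /glue /unglue /=.
have xP : x \in cover P by rewrite (cover_partition PI).
have bP := pblock_mem xP; set B := pblock P x in bP *.
have OB : O \subset B.
  by apply: porbit_sub_stable => [y|]; [apply: st|rewrite mem_pblock].
have n0 : set0 \notin P by rewrite (partition0 PI).
have n0' : set0 \notin P :\ B by rewrite inE (negbTE n0) andbF.
have -> : O :|: B :\: O = B.
  by rewrite setUC -{2}(setID B O) setUC (setIidPr OB).
suff -> : (((B :\: O) |: (P :\ B)) :\ set0) :\ (B :\: O) = P :\ B by exact: setD1K.
have BO_notin : B :\: O \notin P :\ B.
  have [->|/set0Pn [y yBO]] := eqVneq (B :\: O) set0; first by [].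
  apply/negP => /setD1P [neq PBO]; have := yBO; rewrite inE => /andP [_ yB].
  move: neq; rewrite -(def_pblock (partition_trivIset PI) PBO yBO).
  by rewrite (def_pblock (partition_trivIset PI) bP yB) eqxx.
by rewrite setDDl [[set set0] :|: _]setUC -setDDl setU1K // setD1_notin.
Qed.

Let unglue_glueable P : is_stable_partition I P -> glueable (unglue P).
Proof.
move=> /andP [PI /stable_blocksP st]; rewrite /glueable /unglue /=.
have xP : x \in cover P by rewrite (cover_partition PI).
have bP := pblock_mem xP; set B := pblock P x in bP *.
have OB : O \subset B.
  by apply: porbit_sub_stable => [y|]; [apply: st|rewrite mem_pblock].
have n0' : set0 \notin P :\ B by rewrite inE (partition0 PI) andbF.
have BI := partitionS PI bP; have PB := partitionD1 PI bP.
have stBO y : y \in B :\: O -> s y \in B :\: O.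
  rewrite !inE => /andP [nyO yB]; rewrite (st _ _ bP yB) andbT.
  by rewrite mem_porbit_step.
apply/andP; split; [apply/andP; split|].
- have [BO0|nBO] := eqVneq (B :\: O) set0.
    rewrite BO0 setU1K //; suff -> : J = I :\: B by [].
    rewrite /J; congr (_ :\: _); apply/eqP.
    by rewrite eqEsubset OB -setD_eq0 BO0 eqxx.
  rewrite setD1_notin; last first.
    by rewrite in_setU1 negb_or eq_sym nBO.
  suff -> : J = (B :\: O) :|: (I :\: B).
    apply: partitionU1 => //; rewrite disjoint_sym disjoints_subset.
    by apply/subsetP => y; rewrite !inE => /andP [/negbTE -> _]; rewrite andbF.
  apply/setP => y; have /implyP := subsetP OB y; have /implyP := subsetP BI y.
  by rewrite !inE; case: (y \in O); case: (y \in B); case: (y \in I).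
- apply/stable_blocksP => C y /setD1P [_ /setU1P [->|/setD1P [_ PC]]]; first exact: stBO.
  exact: st.
- by rewrite !inE eqxx; case: eqP.
Qed.

Lemma card_glue w : glueable w -> #|glue w| = (#|w.1| + (w.2 == set0))%N.
Proof.
move=> gw; rewrite /glue cardsU1 (rest_notin gw) [in RHS](cardsD1 w.2).
case/andP: gw => /andP [PJ _]; rewrite in_setU1; case: eqP => [->|_] /= w2.
  by rewrite (partition0 PJ) add0n addnC.
by rewrite w2 addn0.
Qed.

Lemma sum_stable_partitions_of_noncycle (R : comPzRingType) : O != I ->
  \sum_(P | is_stable_partition I P) partition_weight R #|P| = 0.
Proof.
move=> neq; rewrite (reindex_onto glue unglue) => [|P /unglueK //].
rewrite (eq_bigl glueable) => [|w]; last first.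
  apply/andP/idP => [[gI /eqP <-]|gw]; first exact: unglue_glueable.
  by rewrite glue_stable // glueK.
rewrite (eq_bigr _ (fun w gw => congr1 _ (card_glue gw))).
rewrite -(pair_big_dep (is_stable_partition J) (fun P B => B \in set0 |: P)
  (fun P B => partition_weight R (#|P| + (B == set0)))) /=.
apply: big1 => P /andP [PJ _]; rewrite big_setU1 ?(partition0 PJ) //= eqxx addn1.
rewrite (eq_bigr (fun=> partition_weight R #|P|)) => [|B PB]; last first.
  by rewrite (negbTE (partition_neq0 PJ PB)) addn0.
rewrite sumr_const -mulr_natl partition_weightS // card_gt0.
(* The cancellation requires at least one block in [P], which holds because [O] is not all of
   [I]. *)
apply: contraNneq neq => P0; rewrite eqEsubset OI -setD_eq0 -/J.
by rewrite -(cover_partition PJ) P0 /cover big_set0 eqxx.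
Qed.

Lemma sum_stable_partitions (R : comPzRingType) :
  \sum_(P | is_stable_partition I P) partition_weight R #|P| =
  if I \in porbits s then - 1 else 0.
Proof.
have -> : (I \in porbits s) = (O == I).
  apply/imsetP/eqP => [[y _ IE]|<-]; last by exists x.
  by apply/eqP; rewrite IE eq_porbit_mem -IE.
have [OE|neq] := eqVneq O I; last exact: sum_stable_partitions_of_noncycle.
rewrite (eq_bigl _ _ (fun P => stable_partition_of_cycle P OE)) big_pred1_eq.
by rewrite cards1 /partition_weight expr1 mulr1.
Qed.

End StablePartitions.

(** * Cycle-sums in terms of principal minors *)

Section MinorsOfPartitions.

Variable K : comNzRingType.

(** Sylvester's determinant identity, from two factorisations of one block matrix into triangular
    ones. *)
Lemma det_add1_mulC m n (X : 'M[K]_(m, n)) (Y : 'M[K]_(n, m)) :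
  \det (1%:M + X *m Y) = \det (1%:M + Y *m X).
Proof.
pose N := block_mx 1%:M (- Y) X 1%:M.
have NL : N = block_mx 1%:M 0 X 1%:M *m block_mx 1%:M (- Y) 0 (1%:M + X *m Y).
  rewrite mulmx_block ?mul1mx ?mulmx1 ?mul0mx ?mulmx0 ?addr0 ?add0r mulmxN.
  by rewrite addrC addrK.
have NR : N = block_mx (1%:M + Y *m X) (- Y) 0 1%:M *m block_mx 1%:M 0 X 1%:M.
  rewrite mulmx_block ?mul1mx ?mulmx1 ?mul0mx ?mulmx0 ?addr0 ?add0r mulNmx.
  by rewrite addrK.
have := congr1 determinant NL; rewrite {1}NR !det_mulmx !det_ublock !det_lblock.
by rewrite !det1 !mul1r !mulr1.
Qed.

Variables (n : nat) (A : 'M[K]_n).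

(** Padding with the identity gives all principal minors the same size [n], so that they multiply as
    determinants. *)
Definition block_completion (B : {set 'I_n}) : 'M[K]_n :=
  \matrix_(i, j) if (i \in B) && (j \in B) then A i j else (i == j)%:R.

Lemma principal_minorE J : principal_minor A J = \det (block_completion J).
Proof.
rewrite /principal_minor; set M := \matrix_(i, j) _.
pose U : 'M[K]_(#|J|, n) := \matrix_(k, i) (enum_val k == i)%:R.
have UU : U *m U^T = 1%:M.
  apply/matrixP => k l; rewrite !mxE (bigD1 (enum_val k)) //= big1 => [|i ni].
    by rewrite !mxE eqxx mul1r addr0 eq_sym (inj_eq enum_val_inj).
  by rewrite !mxE eq_sym (negbTE ni) mul0r.
(* With [U] the inclusion of the rows in [J], Sylvester's identity turns this into
   [1 + U^T (M - 1) U], which is the padded matrix. *)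
have -> : M = 1%:M + ((M - 1%:M) *m U) *m U^T.
  by rewrite -mulmxA UU mulmx1 addrC subrK.
rewrite det_add1_mulC; congr determinant; apply/matrixP => i j.
have sumU (F : 'I_#|J| -> K) i0 :
    \sum_k U k i0 * F k = if i0 \in J then \sum_(k | enum_val k == i0) F k else 0.
  rewrite (big_mkcond (fun k => _ == _)); case: ifP => [_|ni].
    by apply: eq_bigr => k _; rewrite mxE; case: eqP; rewrite ?mul1r ?mul0r.
  apply: big1 => k _; rewrite mxE; case: eqP => [ki|]; last by rewrite mul0r.
  by rewrite -ki enum_valP in ni.
have sum1 (F : 'I_#|J| -> K) k : \sum_(l | enum_val l == enum_val k) F l = F k.
  by rewrite (eq_bigl (pred1 k)) ?big_pred1_eq // => l; rewrite (inj_eq enum_val_inj).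
rewrite [LHS]mxE addrC [RHS]mxE mxE.
rewrite (eq_bigr (fun k => U k i * ((M - 1%:M) *m U) k j)) => [|k _]; last by rewrite mxE.
rewrite sumU; have [iJ|niJ] /= := boolP (i \in J); last by rewrite add0r mxE.
rewrite -{1 2}(enum_rankK_in iJ iJ) sum1; set k := enum_rank_in _ _.
rewrite mxE (eq_bigr (fun l => U l j * (M - 1%:M) k l)) => [|l _]; last exact: mulrC.
rewrite sumU; have [jJ|njJ] /= := boolP (j \in J); last by rewrite add0r mxE enum_rankK_in.
rewrite -(enum_rankK_in jJ jJ) sum1; set l := enum_rank_in _ _.
by rewrite !mxE -(inj_eq enum_val_inj) !enum_rankK_in // subrK.
Qed.


Definition partition_completion (P : {set {set 'I_n}}) : 'M[K]_n :=
  \matrix_(i, j) if i \in cover P then (if j \in pblock P i then A i j else 0)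
                 else (i == j)%:R.

(** Induction on the number of blocks: the completions of [B] and of the remaining blocks each act
    as the identity on the rows of the other, so their product is the completion of [P]. *)
Lemma prod_principal_minors P : trivIset P ->
  \prod_(B in P) principal_minor A B = \det (partition_completion P).
Proof.
move: {2}#|P| (erefl #|P|) => m; elim: m P => [|m IH] P cardP tP.
  move/eqP: cardP; rewrite cards_eq0 => /eqP ->; rewrite big_set0.
  rewrite -(det1 K n); congr determinant; apply/matrixP => i j.
  by rewrite !mxE /cover big_set0 inE.
have /set0Pn [B PB] : P != set0 by rewrite -cards_eq0 cardP.
have tP' : trivIset (P :\ B) by apply: trivIsetD.
have cP' : #|P :\ B| = m by move: cardP; rewrite (cardsD1 B) PB => -[].
rewrite (big_setD1 B) //= (IH _ cP' tP') principal_minorE -det_mulmx.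
congr determinant; apply/matrixP => i j; rewrite mxE [RHS]mxE.
have cov := coverD1 tP PB.
have [iB|niB] := boolP (i \in B).
  have iP : i \in cover P by apply/bigcupP; exists B.
  rewrite iP (def_pblock tP PB iB).
  rewrite (eq_bigr (fun k => if k == j then (if j \in B then A i j else 0) else 0)) => [|k _].
    by rewrite -big_mkcond big_pred1_eq.
  rewrite !mxE iB cov inE /=; have [kB|nkB] /= := boolP (k \in B).
    by case: eqP => [<-|]; rewrite ?kB ?mulr1 ?mulr0.
  have -> : (i == k) = false by apply: contraNF nkB => /eqP <-.
  by rewrite mul0r; case: eqP => // <-; rewrite (negbTE nkB).
rewrite (bigD1 i) //= big1 => [|k nki]; last first.
  by rewrite mxE (negbTE niB) /= eq_sym (negbTE nki) mul0r.
rewrite !mxE (negbTE niB) eqxx mul1r addr0 cov inE niB /=.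
case: ifP => // iP; have := pblock_mem iP; set C := pblock P i => PC.
suff -> : pblock (P :\ B) i = C by [].
apply: def_pblock => //; last by rewrite mem_pblock.
by rewrite !inE PC andbT; apply: contraNneq niB => <-; rewrite mem_pblock.
Qed.

Lemma prod_partition_completion (I : {set 'I_n}) P (s : {perm 'I_n}) :
  partition P I ->
  \prod_i partition_completion P i (s i) =
  if perm_on I s && stable_blocks s P then \prod_(i in I) A i (s i) else 0.
Proof.
move=> PI; have tP := partition_trivIset PI; have cP := cover_partition PI.
case: ifP => [/andP [sI /stable_blocksP st]|].
  rewrite [RHS]big_mkcond; apply: eq_bigr => i _; rewrite mxE cP.
  case: ifP => iI; last by rewrite (out_perm sI) ?eqxx ?iI.
  have iP : i \in cover P by rewrite cP.
  by rewrite (st _ _ (pblock_mem iP)) ?mem_pblock.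
move/negbT; rewrite negb_and => nst.
suff [i i0] : exists i, partition_completion P i (s i) = 0.
  by rewrite (bigD1 i) //= i0 mul0r.
case/orP: nst => [nsI|].
  case: (pickP [pred i | (s i != i) && (i \notin I)]) => [i /= /andP [si iI]|no].
    by exists i; rewrite mxE cP (negbTE iI) eq_sym (negbTE si).
  case/negP: nsI; apply/subsetP => i; rewrite inE => si.
  by have := no i; rewrite /= si => /negbFE.
case/forall_inPn => B PB /forall_inPn [i iB si]; exists i.
have iP : i \in cover P by apply/bigcupP; exists B.
by rewrite mxE iP (def_pblock tP PB iB) (negbTE si).
Qed.

(* [porbits s] consists of [I] and of the fixed points of [s]. *)
Lemma odd_cyclic_on (I : {set 'I_n}) (s : {perm 'I_n}) : I != set0 ->
  cyclic_on I s -> odd_perm s = ~~ odd #|I|.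
Proof.
move=> nI /andP [sI sO].
have fixed x : x \notin I -> porbit s x = [set x].
  move=> xI; apply/setP => y; rewrite inE; apply/porbitP/eqP => [[i ->]|->].
    by elim: i => [|i IH]; rewrite ?perm1 // expgSr permM IH (out_perm sI).
  by exists 0%N; rewrite perm1.
have -> : odd_perm s = odd #|'I_n| (+) odd #|porbits s| by [].
have -> : porbits s = I |: [set [set x] | x in ~: I].
  apply/setP => C; apply/imsetP/setU1P => [[x _ ->]|].
    have [xI|nxI] := boolP (x \in I); [left|right].
      by case/imsetP: sO => y _ IE; apply/eqP; rewrite IE eq_porbit_mem -IE.
    by apply/imsetP; exists x; rewrite ?inE // fixed.
  case=> [->|/imsetP [x nxI ->]]; first by case/imsetP: sO => x _ ->; exists x.
  by exists x; rewrite ?fixed // -in_setC.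
rewrite cardsU1 card_imset => [|x y]; last exact: set1_inj.
have -> : I \notin [set [set x] | x in ~: I].
  by apply/imsetP => -[x]; rewrite inE => nxI IE; rewrite IE set11 in nxI.
by rewrite -(cardsC I) !oddD; case: (odd _); case: (odd _).
Qed.

(** After Leibniz expansion and an exchange of sums, each permutation carries the total weight of
    its stable partitions, which is -1 for a cycle on [I] and 0 for the others supported in [I].
    With k the size of [I], the sign of the cycle is [(-1)^(k-1)], which cancels that -1 and the
    factor [(-1)^k]. *)
Lemma cycle_sum_principal_minors (I : {set 'I_n}) : I != set0 ->
  cycle_sum A I =
  \sum_(P : {set {set 'I_n}} | partition P I)
    (-1) ^+ (#|I| + #|P|) * ((#|P|.-1)`!)%:R * \prod_(B in P) principal_minor A B.
Proof.
move=> nI; have /set0Pn [x xI] := nI.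
pose F (s : {perm 'I_n}) := \prod_(i in I) A i (s i).
transitivity (\sum_(P | partition P I) \sum_(s : {perm 'I_n})
    if perm_on I s && stable_blocks s P
    then (-1) ^+ #|I| * ((-1) ^+ s * F s * partition_weight K #|P|) else 0).
  rewrite exchange_big /= /cycle_sum big_mkcond; apply: eq_bigr => s _.
  rewrite -big_mkcondr; case: (boolP (perm_on I s)) => sI; last first.
    by rewrite /cyclic_on (negbTE sI) big1 // => P; rewrite andbF.
  rewrite /= -!mulr_sumr (sum_stable_partitions sI xI) /cyclic_on sI /=.
  case: ifP => cyc; last by rewrite !mulr0.
  rewrite (odd_cyclic_on nI) /cyclic_on ?sI //.
  rewrite -[in RHS]signr_odd -/(F s) -mulrA !mulr_sign.
  by case: (odd _) => /=; ring.
apply: eq_bigr => P PI; rewrite (prod_principal_minors (partition_trivIset PI)).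
rewrite mulr_sumr; apply: eq_bigr => s _.
rewrite (prod_partition_completion _ PI); case: ifP => _; last by rewrite !mulr0.
rewrite exprD /partition_weight -/(F s) -!mulrA; congr (_ * _).
by rewrite [LHS]mulrA [LHS]mulrC -mulrA.
Qed.

End MinorsOfPartitions.

(** * Cyclic permutations of two and three points *)

Section SmallCycles.

Variable T : finType.
Implicit Types (I : {set T}) (s : {perm T}) (a b c x : T).

Lemma cyclic_on_perm I s : cyclic_on I s -> perm_on I s.
Proof. by case/andP. Qed.

Lemma cyclic_on_mem I s x : cyclic_on I s -> x \in I -> s x \in I.
Proof. by move/cyclic_on_perm => sI xI; rewrite perm_closed. Qed.

(** [I] is a single orbit, hence lies in every closed set that it meets. *)
Lemma cyclic_on_sub I s (B : {set T}) x : cyclic_on I s -> x \in I -> x \in B ->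
  (forall y, y \in B -> s y \in B) -> I \subset B.
Proof.
move=> /andP [_ /imsetP [y _ ->]] xy xB sB.
have /eqP <- : porbit s x == porbit s y by rewrite eq_porbit_mem.
exact: porbit_sub_stable.
Qed.

Lemma cyclic_on_neq I s x : cyclic_on I s -> (1 < #|I|)%N -> x \in I -> s x != x.
Proof.
move=> cI I1 xI; apply: contraTneq I1 => sx; rewrite -leqNgt -(cards1 x).
apply/subset_leq_card/(cyclic_on_sub cI xI); first exact: set11.
by move=> y /set1P ->; rewrite sx set11.
Qed.

Lemma cyclic_onP I s x : x \in I -> perm_on I s -> I \subset porbit s x -> cyclic_on I s.
Proof.
move=> xI sI Isub; rewrite /cyclic_on sI; apply/imsetP; exists x => //.
apply/eqP; rewrite eqEsubset Isub.
by apply: porbit_sub_stable => // y yI; rewrite perm_closed.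
Qed.

Lemma eq_on_support I s t : perm_on I s -> perm_on I t -> {in I, s =1 t} -> s = t.
Proof.
move=> sI tI st; apply/permP => x; have [/st //|xI] := boolP (x \in I).
by rewrite (out_perm sI) // (out_perm tI).
Qed.

Lemma cards3 a b c : a != b -> a != c -> b != c -> #|[set a; b; c]| = 3.
Proof.
move=> ab ac bc; rewrite setUC cardsU1 cards2 ab !inE !(eq_sym c).
by rewrite (negbTE ac) (negbTE bc).
Qed.

Lemma cyclic_on2E a b s : a != b -> cyclic_on [set a; b] s = (s == tperm a b).
Proof.
move=> ab; have I1 : (1 < #|[set a; b]|)%N by rewrite cards2 ab.
apply/idP/eqP => [cs|->].
  apply: (eq_on_support (cyclic_on_perm cs) (tperm_on a b)) => x.
  have := cyclic_on_mem cs; have := cyclic_on_neq cs I1.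
  by move=> ne me xI; have := me x xI; have := ne x xI; move: xI; 
    rewrite !inE => /orP [] /eqP ->; rewrite ?tpermL ?tpermR => /negbTE -> ; rewrite ?orbF => /eqP.
apply: (@cyclic_onP _ _ a); rewrite ?tperm_on ?set21 //.
apply/subsetP => x; rewrite !inE => /orP [] /eqP ->; first exact: porbit_id.
by have := mem_porbit_step (tperm a b) a a; rewrite tpermL porbit_id.
Qed.

Definition cycle3 a b c : {perm T} := (tperm a b * tperm a c)%g.

Section Cycle3.

Variables a b c : T.
Hypotheses (ab : a != b) (ac : a != c) (bc : b != c).

Lemma cycle3E : [/\ cycle3 a b c a = b, cycle3 a b c b = c & cycle3 a b c c = a].
Proof.
by rewrite !permM tpermL tpermR (tpermD ac bc) tpermL tpermR tpermD // eq_sym.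
Qed.

Lemma cycle3_on : perm_on [set a; b; c] (cycle3 a b c).
Proof.
apply: perm_onM; apply: subset_trans (tperm_on _ _) _; apply/subsetP => x;
  by rewrite !inE => /orP [] ->; rewrite ?orbT.
Qed.

Lemma cyclic_on_cycle3 : cyclic_on [set a; b; c] (cycle3 a b c).
Proof.
have [sa sb sc] := cycle3E.
apply: (@cyclic_onP _ _ a); rewrite ?cycle3_on ?inE ?eqxx //.
have bO : b \in porbit (cycle3 a b c) a by rewrite -[X in X \in _]sa mem_porbit_step porbit_id.
have cO : c \in porbit (cycle3 a b c) a by rewrite -[X in X \in _]sb mem_porbit_step.
by apply/subsetP => x; rewrite !inE => /orP [/orP []|] /eqP ->; rewrite ?porbit_id.
Qed.

Lemma cyclic_on3_eq s : cyclic_on [set a; b; c] s -> s a = b -> s = cycle3 a b c.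
Proof.
move=> cs sa; have [ca cb cc] := cycle3E.
have I2 := cards3 ab ac bc.
have I1 : (1 < #|[set a; b; c]|)%N by rewrite I2.
have sb : s b = c.
  have : s b \in [set a; b; c] by apply: (cyclic_on_mem cs); rewrite !inE eqxx orbT.
  have : s b != b by apply: (cyclic_on_neq cs); rewrite ?inE ?eqxx ?orbT.
  rewrite !inE => /negbTE ->; rewrite orbF => /orP [/eqP sba|/eqP //].
  (* If [s b] were [a], the pair [a], [b] would be closed under [s] and contain the whole orbit. *)
  have : [set a; b; c] \subset [set a; b].
    apply: (cyclic_on_sub cs (x := a)); rewrite ?inE ?eqxx // => y.
    by rewrite !inE => /orP [] /eqP ->; rewrite ?sa ?sba eqxx ?orbT.
  by move/subset_leq_card; rewrite I2 cards2 ab.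
have sc : s c = a.
  have : s c \in [set a; b; c] by apply: (cyclic_on_mem cs); rewrite !inE eqxx orbT.
  have : s c != c by apply: (cyclic_on_neq cs); rewrite ?inE ?eqxx ?orbT.
  rewrite !inE => /negbTE ->; rewrite orbF => /orP [/eqP //|].
  by rewrite -sa (inj_eq perm_inj) eq_sym (negbTE ac).
apply: (eq_on_support (cyclic_on_perm cs) cycle3_on) => x.
by rewrite !inE => /orP [/orP []|] /eqP ->; rewrite ?sa ?sb ?sc ?ca ?cb ?cc.
Qed.

End Cycle3.

Lemma cyclic_on3E a b c s : a != b -> a != c -> b != c ->
  cyclic_on [set a; b; c] s = (s == cycle3 a b c) || (s == cycle3 a c b).
Proof.
move=> ab ac bc; have cb : c != b by rewrite eq_sym.
have Iac : [set a; b; c] = [set a; c; b] by rewrite setUAC.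
apply/idP/orP => [cs|[] /eqP ->]; last 2 first.
- exact: cyclic_on_cycle3.
- by rewrite Iac; apply: cyclic_on_cycle3.
have : s a \in [set a; b; c] by apply: (cyclic_on_mem cs); rewrite !inE eqxx.
have : s a != a.
  by apply: (cyclic_on_neq cs); rewrite ?inE ?eqxx ?cards3.
rewrite !inE => /negbTE -> /= /orP [] /eqP sa; [left|right]; apply/eqP.
  exact: cyclic_on3_eq.
by apply: cyclic_on3_eq => //; rewrite -Iac.
Qed.

End SmallCycles.

Lemma cycle_sum2 (K : comNzRingType) n (A : 'M[K]_n) a b : a != b ->
  cycle_sum A [set a; b] = A a b * A b a.
Proof.
move=> ab; rewrite /cycle_sum (eq_bigl _ _ (fun s => cyclic_on2E s ab)) big_pred1_eq.
by rewrite big_setU1 ?big_set1 ?inE //= tpermL tpermR.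
Qed.

Lemma cycle_sum3 (K : comNzRingType) n (A : 'M[K]_n) a b c :
  a != b -> a != c -> b != c ->
  cycle_sum A [set a; b; c] = A a b * A b c * A c a + A a c * A c b * A b a.
Proof.
move=> ab ac bc; have cb : c != b by rewrite eq_sym.
rewrite /cycle_sum (eq_bigl _ _ (fun s => cyclic_on3E s ab ac bc)).
have prodI (F : 'I_n -> K) : \prod_(i in [set a; b; c]) F i = F a * F b * F c.
  by rewrite -setUA !big_setU1 ?big_set1 ?inE ?negb_or ?ab ?ac ?bc //= mulrA.
have [sa sb sc] := cycle3E ab ac bc; have [ta tc tb] := cycle3E ac ab cb.
have neq : cycle3 a c b != cycle3 a b c.
  by apply/eqP => /permP /(_ a) /eqP; rewrite sa ta (negbTE cb).
rewrite (bigD1 (cycle3 a b c)) ?eqxx //= (big_pred1 (cycle3 a c b)) => [|s].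
  rewrite !prodI sa sb sc ta tb tc; ring.
by case: eqP => [->|_] /=; rewrite ?andbT ?andbF // eq_sym (negbTE neq).
Qed.

(** * Evaluation and discriminants *)

Section Evaluation.

Variables (K : numFieldType) (n : nat).

Lemma mmap_comp (B C : comNzRingType) (f : {rmorphism B -> C}) k l
    (h : 'I_k -> {mpoly B[l]}) (y : 'I_l -> C) (P : {mpoly B[k]}) :
  mmap f y (mmap (@mpolyC _ B) h P) = mmap f (fun i => mmap f y (h i)) P.
Proof.
rewrite [mmap (@mpolyC _ B) h P]/mmap rmorph_sum; apply: eq_bigr => m _ /=.
rewrite rmorphM /= mmapC rmorph_prod; congr (_ * _).
by apply: eq_bigr => i _; rewrite rmorphXn.
Qed.

Lemma eval_cycle_sum_in_minors (A : 'M[K]_n) (I : {set 'I_n}) : I != set0 ->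
  evalA (principal_minor A) (cycle_sum_in_minors I) = cycle_sum A I.
Proof.
move=> nI; rewrite cycle_sum_principal_minors // /evalA /cycle_sum_in_minors.
rewrite rmorph_sum; apply: eq_bigr => P _ /=.
rewrite !rmorphM rmorphXn rmorphN rmorph1 rmorph_nat rmorph_prod; congr (_ * _).
by apply: eq_bigr => B _; rewrite /= mmapX mmap1U enum_rankK.
Qed.

Lemma eval_in_minors (A : 'M[K]_n) (P : Tpoly n) :
  evalA (principal_minor A) (in_minors P) = evalT (cycle_sum A) P.
Proof.
rewrite /evalA /in_minors /comp_mpoly mmap_comp /evalT.
apply: eq_bigr => m _; congr (_ * _); apply: mmap1_eq => k.
rewrite tnth_mktuple -[LHS]/(evalA _ _) eval_cycle_sum_in_minors //.
by rewrite -card_gt0; apply: ltnW; apply: (valP (enum_val k)).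
Qed.

Definition evalTm (t : {set 'I_n} -> K) : {rmorphism Tpoly n -> K} :=
  mmap ratr (fun k => t (val (enum_val k))).

Lemma evalT_Tvar (t : {set 'I_n} -> K) (I : {set 'I_n}) : (1 < #|I|)%N -> evalTm t (Tvar I) = t I.
Proof.
by move=> I1; rewrite /Tvar insubT /= mmapX mmap1U enum_rankK.
Qed.

End Evaluation.

(** Parity of degrees after embedding by [f]: [d] has degree 1 and [c] degree 0, so the left side
    has odd degree while a nonzero square has even degree. *)
Lemma nonsquare_of_odd_degree (B : idomainType) (f : {rmorphism B -> {poly B}})
    (a b c d : B) : injective f -> size (f d) = 2%N -> f c = c%:P ->
  c != 0 -> b != 0 -> b ^+ 2 * (d * c) != a ^+ 2.
Proof.
move=> injf fd fc nc nb; apply/eqP => E.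
have nf x : x != 0 -> f x != 0 by move=> nx; rewrite -(rmorph0 f) (inj_eq injf).
have nd : d != 0 by apply: contra_eq_neq fd => ->; rewrite rmorph0 size_poly0.
have sq (p : {poly B}) : p != 0 -> size (p ^+ 2) = (size p).*2.-1.
  by move=> np; rewrite expr2 size_mul // addnn.
have na : a != 0.
  by apply: contra_eq_neq E => ->; rewrite expr0n !mulf_neq0 ?expf_neq0.
have : size (f (b ^+ 2 * (d * c))) = size (f (a ^+ 2)) by rewrite E.
rewrite rmorphM !rmorphXn [f (d * c)]rmorphM fc mulrA mulrC size_Cmul //.
rewrite size_mul ?expf_neq0 ?nf // fd !sq ?nf //.
have : (0 < size (f a))%N by rewrite size_poly_gt0 nf.
have : (0 < size (f b))%N by rewrite size_poly_gt0 nf.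
case: (size _) => // x _; case: (size _) => // y _.
by rewrite !doubleS /= addn2 => -[] /(congr1 odd); rewrite /= !odd_double.
Qed.

Section Discriminants.

Variables (n : nat) (o : 'I_n).

Definition pair_index : finType :=
  {p : 'I_n * 'I_n | [&& (p.1 < p.2)%N, p.1 != o & p.2 != o]}.

Implicit Types q : pair_index.

Definition fst_of q : 'I_n := (val q).1.
Definition snd_of q : 'I_n := (val q).2.

Lemma pair_indexP q :
  [/\ (fst_of q < snd_of q)%N, fst_of q != snd_of q, fst_of q != o & snd_of q != o].
Proof.
have /and3P [lt no1 no2] := valP q; split=> //.
by rewrite -val_eqE neq_ltn lt.
Qed.

Definition disc q : Tpoly n :=
  Tvar [set o; fst_of q; snd_of q] ^+ 2
  - 4%:R * Tvar [set o; fst_of q] * Tvar [set o; snd_of q] * Tvar [set fst_of q; snd_of q].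

Lemma pair_subset_gt1 q : (1 < #|[set fst_of q; snd_of q]|)%N.
Proof. by have [_ neq _ _] := pair_indexP q; rewrite cards2 neq. Qed.

(* [disc q] has degree 1 in the variable T_ij attached to [q = (i, j)], while the
   other discriminants do not involve it; so no product of distinct discriminants
   is a square. *)
Definition isolate q : {rmorphism Tpoly n -> {poly Tpoly n}} :=
  mmap (@polyC _ \o @mpolyC _ rat)
    (fun k => if val (enum_val k) == [set fst_of q; snd_of q] then 'X
              else ('X_k : Tpoly n)%:P).

Lemma isolate_Tvar q (I : {set 'I_n}) : (1 < #|I|)%N ->
  isolate q (Tvar I) = if I == [set fst_of q; snd_of q] then 'X else (Tvar I)%:P.
Proof.
by move=> I1; rewrite /Tvar insubT /= mmapX mmap1U enum_rankK.
Qed.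

(** Substituting the variable itself for ['X] undoes the isolation. *)
Lemma isolate_inj q : injective (isolate q).
Proof.
pose X := Tvar [set fst_of q; snd_of q].
suff K p : (isolate q p).[X] = p by apply: (can_inj (g := horner_eval X)).
rewrite -[LHS]/(horner_eval X (isolate q p)) /isolate /= /mmap rmorph_sum /=.
rewrite [RHS]mpolyE; apply: eq_bigr => m _; rewrite rmorphM /= !horner_evalE hornerC.
rewrite horner_prod -mul_mpolyC mpolyXE_id; congr (_ * _); apply: eq_bigr => k _.
rewrite horner_exp; congr (_ ^+ _).
case: eqP => [kE|_]; last by rewrite hornerC.
by rewrite hornerX /X /Tvar -kE valK enum_valK.
Qed.

Lemma set2_o_neq q (I : {set 'I_n}) : o \in I -> (I == [set fst_of q; snd_of q]) = false.
Proof.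
move=> oI; apply: contraTF oI => /eqP ->; have [_ _ no1 no2] := pair_indexP q.
by rewrite !inE negb_or !(eq_sym o) no1.
Qed.

Lemma pair_set_inj q q' :
  ([set fst_of q'; snd_of q'] == [set fst_of q; snd_of q]) = (q' == q).
Proof.
apply/eqP/eqP => [E|-> //].
have [lt _ _ _] := pair_indexP q; have [lt' _ _ _] := pair_indexP q'.
have : fst_of q' \in [set fst_of q; snd_of q] by rewrite -E set21.
have : snd_of q' \in [set fst_of q; snd_of q] by rewrite -E set22.
rewrite !inE => /orP [] /eqP s /orP [] /eqP f; apply: val_inj.
- by rewrite s f ltnn in lt'.
- by rewrite f s in lt'; have := ltn_trans lt lt'; rewrite ltnn.
- by rewrite [LHS]surjective_pairing [RHS]surjective_pairing; congr pair.
- by rewrite s f ltnn in lt'.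
Qed.

Lemma Tvar_neq0 (I : {set 'I_n}) : (1 < #|I|)%N -> Tvar I != 0 :> Tpoly n.
Proof. by move=> I1; rewrite /Tvar insubT -msupp_eq0 msuppX. Qed.

Lemma Tvar_card1 (i : 'I_n) : i != o -> (1 < #|[set o; i]|)%N.
Proof. by move=> io; rewrite cards2 eq_sym io. Qed.

Lemma Tvar_card2 q : (1 < #|[set o; fst_of q; snd_of q]|)%N.
Proof. by have [_ ne no1 no2] := pair_indexP q; rewrite cards3 // eq_sym. Qed.

Lemma isolate_disc_other q q' : q' != q -> isolate q (disc q') = (disc q')%:P.
Proof.
move=> neq; have [_ _ no1 no2] := pair_indexP q'.
rewrite /disc rmorphB rmorphXn !rmorphM rmorph_nat /=.
rewrite !isolate_Tvar ?Tvar_card1 ?Tvar_card2 ?pair_subset_gt1 //.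
rewrite pair_set_inj (negbTE neq) !set2_o_neq ?inE ?eqxx //.
by rewrite rmorphB rmorphXn !rmorphM rmorph_nat.
Qed.

Lemma size_isolate_disc q : size (isolate q (disc q)) = 2%N.
Proof.
have [_ _ no1 no2] := pair_indexP q.
rewrite /disc rmorphB rmorphXn !rmorphM rmorph_nat /=.
rewrite !isolate_Tvar ?Tvar_card1 ?Tvar_card2 ?pair_subset_gt1 //.
rewrite eqxx !set2_o_neq ?inE ?eqxx //.
set u := Tvar _; set v := Tvar _; set w := Tvar _.
have -> : u%:P ^+ 2 - 4%:R * v%:P * w%:P * 'X = (- (4%:R * v * w))%:P * 'X + (u ^+ 2)%:P.
  by rewrite !(rmorphN, rmorphM, rmorphXn, rmorph_nat) /=; ring.
have nz : - (4%:R * v * w) != 0.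
  rewrite oppr_eq0 !mulf_neq0 ?Tvar_neq0 ?Tvar_card1 //.
  by rewrite -mpolyC_nat mpolyC_eq0.
by rewrite size_MXaddC polyC_eq0 (negbTE nz) size_polyC nz.
Qed.

Lemma disc_neq0 q : disc q != 0.
Proof. by apply: contra_eq_neq (size_isolate_disc q) => ->; rewrite rmorph0 size_poly0. Qed.

Lemma disc_product_nonsquare (S : {set pair_index}) (a b : Tpoly n) :
  S != set0 -> b != 0 -> b ^+ 2 * \prod_(q in S) disc q != a ^+ 2.
Proof.
case/set0Pn => q qS nb; rewrite (big_setD1 q) //.
apply: (@nonsquare_of_odd_degree (Tpoly n) (isolate q)); [| | | |exact: nb].
- exact: isolate_inj.
- exact: size_isolate_disc.
- rewrite rmorph_prod [RHS]rmorph_prod; apply: eq_bigr => q'.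
  by rewrite !inE => /andP [neq _]; apply: isolate_disc_other.
- by apply/prodf_neq0 => q' _; apply: disc_neq0.
Qed.

End Discriminants.

(** * The signed sums E_eps *)

Section SignedSum.

Variables (n : nat) (o : 'I_n).
Notation Q := (pair_index o).

(** The shape of E_eps over any commutative ring, with [h] for one half and [x i j] for the signed
    root, so that it can be formed with formal roots, in [L] and at the cycle-sums. *)
Definition signed_sum (B : comNzRingType) (t : {set 'I_n} -> B) (h : B)
    (x : 'I_n -> 'I_n -> B) : B :=
  2%:R ^+ (n - 2) * (\prod_(i | i != o) t [set o; i]) * t (~: [set o])
  - h * \sum_(s : {perm 'I_n} | cyclic_on (~: [set o]) s)
          \prod_(i | i != o) (t [set o; i; s i] + (-1) ^+ (s i < i)%N * x i (s i)).

Lemma rmorph_signed_sum (B C : comNzRingType) (g : {rmorphism B -> C}) t h x :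
  g (signed_sum t h x) =
  signed_sum (fun I => g (t I)) (g h) (fun i j => g (x i j)).
Proof.
rewrite /signed_sum rmorphB !rmorphM rmorphXn rmorph_nat !rmorph_prod rmorph_sum.
congr (_ - _ * _); apply: eq_bigr => s _; rewrite rmorph_prod.
by apply: eq_bigr => i _; rewrite rmorphD rmorphM rmorph_sign.
Qed.

Lemma cyclic_on_rest (s : {perm 'I_n}) i : (4 <= n)%N ->
  cyclic_on (~: [set o]) s -> i != o -> (s i != o) /\ (s i != i).
Proof.
move=> n4 cs io; have iI : i \in ~: [set o] by rewrite !inE.
split; first by have := cyclic_on_mem cs iI; rewrite !inE.
by apply: (cyclic_on_neq cs) => //; rewrite cardsC1 card_ord; case: n n4 => [|[|[]]].
Qed.

(** A cycle on at least two points has no fixed point, so only distinct indices other than [o] and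
    sets of size at least 2 occur. *)
Lemma eq_signed_sum (B : comNzRingType) (t t' : {set 'I_n} -> B) h
    (x x' : 'I_n -> 'I_n -> B) : (4 <= n)%N ->
  (forall I : {set 'I_n}, (1 < #|I|)%N -> t I = t' I) ->
  (forall i j, i != o -> j != o -> i != j -> x i j = x' i j) ->
  signed_sum t h x = signed_sum t' h x'.
Proof.
move=> n4 tt xx; rewrite /signed_sum; congr (_ * _ * _ - _ * _).
- by apply: eq_bigr => i io; rewrite tt // cards2 eq_sym io.
- by rewrite tt // cardsC1 card_ord; case: n n4 => [|[|[]]].
- apply: eq_bigr => s cs; apply: eq_bigr => i io.
  have [so si] := cyclic_on_rest n4 cs io.
  rewrite tt ?xx // 1?eq_sym //.
  by rewrite cards3 // eq_sym.
Qed.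

Definition lookup (B : nmodType) (y : Q -> B) (i j : 'I_n) : B :=
  if insub (i, j) is Some q then y q else if insub (j, i) is Some q then y q else 0.

Lemma lookup_sym (B : nmodType) (y : Q -> B) i j : lookup y i j = lookup y j i.
Proof.
rewrite /lookup; case: insubP => [q /and3P [/= lt _ _] _|_]; last by case: insubP.
by rewrite insubF //= ltnNge (ltnW lt).
Qed.

Lemma lookup_lt (B : nmodType) (y : Q -> B) i j : i != o -> j != o -> (i < j)%N ->
  exists q : Q, lookup y i j = y q /\ val q = (i, j).
Proof.
move=> io jo lt; have P : [&& ((i, j).1 < (i, j).2)%N, (i, j).1 != o & (i, j).2 != o].
  by rewrite /= lt io jo.
by exists (exist _ (i, j) P); rewrite /lookup insubT.
Qed.

Lemma lookup_map (B C : nmodType) (f : {additive B -> C}) (y : Q -> B) i j :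
  f (lookup y i j) = lookup (f \o y) i j.
Proof.
by rewrite /lookup; case: insub => //=; case: insub => //=; rewrite raddf0.
Qed.

Definition half : Tpoly n := (2%:R^-1 : rat)%:MP.

Lemma halfE : 2%:R * half = 1.
Proof. by rewrite /half -mpolyC_nat -mpolyCM. Qed.

Lemma rmorph_half (F : fieldType) (g : {rmorphism Tpoly n -> F}) : g half = 2%:R^-1.
Proof.
have := congr1 g halfE; rewrite rmorphM rmorph_nat rmorph1 => h2.
have nz : 2%:R != 0 :> F by apply: contra_eq_neq h2 => ->; rewrite mul0r eq_sym oner_eq0.
by rewrite -[LHS](mulKf nz) h2 mulr1.
Qed.

Definition signed_sum_poly : {mpoly (Tpoly n)[#|{: Q}|]} :=
  signed_sum (fun I => (Tvar I)%:MP) half%:MP (lookup (fun q => 'X_(enum_rank q))).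

Lemma eval_signed_sum_poly (B : comNzRingType) (g : {rmorphism Tpoly n -> B}) (y : Q -> B) :
  (4 <= n)%N ->
  eval_at g y signed_sum_poly = signed_sum (fun I => g (Tvar I)) (g half) (lookup y).
Proof.
move=> n4; rewrite /signed_sum_poly rmorph_signed_sum -[in RHS](eval_atC g y half).
apply: eq_signed_sum => // [I _|i j _ _ _]; first by rewrite /= eval_atC.
rewrite lookup_map /lookup.
by case: insub => [q|]; [|case: insub => [q|//]]; rewrite /= eval_atX.
Qed.

(** Each factor becomes [2 A o i A i (s i) A (s i) o]. Over a cycle these multiply to a power of 2,
    the product [c] of the two-cycle sums and the cycle product of [s]; summing over [s] gives the
    cycle-sum of the rest. *)
Lemma signed_sum_cycle_sum (K : fieldType) (A : 'M[K]_n) (x : 'I_n -> 'I_n -> K) :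
  (4 <= n)%N -> 2%:R != 0 :> K ->
  (forall i j, i != o -> j != o -> i != j ->
     (-1) ^+ (j < i)%N * x i j = A o i * A i j * A j o - A o j * A j i * A i o) ->
  signed_sum (cycle_sum A) 2%:R^-1 x = 0.
Proof.
move=> n4 two xE; rewrite /signed_sum.
pose c := \prod_(i | i != o) cycle_sum A [set o; i].
have termE (s : {perm 'I_n}) : cyclic_on (~: [set o]) s ->
    \prod_(i | i != o) (cycle_sum A [set o; i; s i] + (-1) ^+ (s i < i)%N * x i (s i))
    = 2%:R ^+ n.-1 * c * \prod_(i in ~: [set o]) A i (s i).
  move=> cs.
  have -> : 2%:R ^+ n.-1 = \prod_(i : 'I_n | i != o) 2%:R :> K.
    by rewrite prodr_const cardC1 card_ord.
  have -> : \prod_(i in ~: [set o]) A i (s i) = \prod_(i | i != o) A i (s i).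
    by apply: eq_bigl => i; rewrite !inE.
  (* Since [s] permutes the indices other than [o], the entries [A i o] may be listed as
     [A (s i) o]. *)
  have -> : c = (\prod_(i | i != o) A o i) * \prod_(i | i != o) A (s i) o.
    rewrite (_ : \prod_(i | i != o) A (s i) o = \prod_(i | i != o) A i o).
      by rewrite -big_split; apply: eq_bigr => i io; rewrite cycle_sum2 // eq_sym.
    rewrite [RHS](reindex_inj (@perm_inj _ s)); apply: eq_bigl => i.
    by have := perm_closed i (cyclic_on_perm cs); rewrite !inE => ->.
  rewrite -!big_split /=; apply: eq_bigr => i io.
  have [so si] := cyclic_on_rest n4 cs io.
  rewrite xE // 1?eq_sym // cycle_sum3 // 1?eq_sym //; ring.
rewrite (eq_bigr _ termE) -mulr_sumr -/(cycle_sum A (~: [set o])) -/c.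
have -> : n.-1 = (n - 2).+1 by case: n n4 => [|[|m]] // _; rewrite subn2.
by rewrite exprS; field.
Qed.

(* T_1ij is the sum of the two cyclic products and this is their difference, so
   that T_1ij + R_ij and T_1ij - R_ij are twice the cyclic products. *)
Definition cyclic_difference (K : comNzRingType) (A : 'M[K]_n) (q : Q) : K :=
  A o (fst_of q) * A (fst_of q) (snd_of q) * A (snd_of q) o
  - A o (snd_of q) * A (snd_of q) (fst_of q) * A (fst_of q) o.

Lemma cyclic_difference_sqr (K : numFieldType) (A : 'M[K]_n) (q : Q) :
  cyclic_difference A q ^+ 2 = evalTm (cycle_sum A) (disc q).
Proof.
have [_ ne no1 no2] := pair_indexP q.
rewrite /cyclic_difference /disc rmorphB rmorphXn !rmorphM rmorph_nat.
rewrite !evalT_Tvar ?pair_subset_gt1 ?Tvar_card1 ?Tvar_card2 //.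
have on1 : o != fst_of q by rewrite eq_sym.
have on2 : o != snd_of q by rewrite eq_sym.
by rewrite cycle_sum3 ?cycle_sum2 //; ring.
Qed.

Lemma eval_signed_sum_poly_cycle_sum (K : numFieldType) (A : 'M[K]_n) : (4 <= n)%N ->
  eval_at (evalTm (cycle_sum A)) (flip [ffun=> false] (cyclic_difference A))
    signed_sum_poly = 0.
Proof.
move=> n4; rewrite eval_signed_sum_poly // rmorph_half; set y := flip _ _.
rewrite (@eq_signed_sum _ _ (cycle_sum A) _ _ (lookup y)) => // [|I I1].
  apply: signed_sum_cycle_sum => // [|i j io jo]; first by rewrite pnatr_eq0.
  rewrite -val_eqE neq_ltn => /orP [] lt.
    have [q [-> qE]] := lookup_lt y io jo lt.
    by rewrite /y /flip /cyclic_difference /fst_of /snd_of qE ffunE ltnNge (ltnW lt) !mul1r.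
  (* For [j < i] the root is stored at [(j, i)]; the sign -1 of the descent exchanges its two cyclic
     products. *)
  rewrite lookup_sym; have [q [-> qE]] := lookup_lt y jo io lt.
  by rewrite /y /flip /cyclic_difference /fst_of /snd_of qE ffunE lt mul1r mulN1r opprB.
exact: evalT_Tvar.
Qed.

Lemma Eeps_eval (L : fieldType) (iota : {rmorphism Tfrac n -> L}) (Rt : 'I_n -> 'I_n -> L)
    (e : {ffun 'I_n * 'I_n -> bool}) (d : {ffun Q -> bool}) :
  (4 <= n)%N -> is_root_family iota o Rt -> sign_choice e ->
  (forall q, e (val q) = d q) ->
  Eeps iota o Rt e =
  eval_at (iota \o (@tofrac _)) (flip d (fun q => Rt (fst_of q) (snd_of q))) signed_sum_poly.
Proof.
move=> n4 root /forallP ce ed; rewrite eval_signed_sum_poly // rmorph_half.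
transitivity (signed_sum (TL iota) 2%:R^-1 (fun i j => (-1) ^+ e (i, j) * Rt i j)).
  rewrite /Eeps /signed_sum; congr (_ - _ * _); apply: eq_bigr => s _.
  by apply: eq_bigr => i _; rewrite mulrA.
apply: eq_signed_sum => // i j io jo; rewrite -val_eqE neq_ltn => /orP [] lt.
  have [q [-> qE]] := lookup_lt (flip d (fun q => Rt (fst_of q) (snd_of q))) io jo lt.
  by rewrite /flip -ed /fst_of /snd_of qE.
rewrite lookup_sym; have [-> _] := root j i jo io lt.
have [q [-> qE]] := lookup_lt (flip d (fun q => Rt (fst_of q) (snd_of q))) jo io lt.
by rewrite /flip -ed /fst_of /snd_of qE; have /forallP /(_ i) /eqP -> := ce j.
Qed.

Lemma normN_values (L : fieldType) (iota : {rmorphism Tfrac n -> L})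
    (Rt : 'I_n -> 'I_n -> L) : (4 <= n)%N -> is_root_family iota o Rt ->
  normN iota o Rt =
  \prod_(x <- undup [seq eval_at (iota \o (@tofrac _))
                          (flip d (fun q => Rt (fst_of q) (snd_of q))) signed_sum_poly
                    | d <- enum {: {ffun Q -> bool}}]) x.
Proof.
move=> n4 root; apply: perm_big; apply: uniq_perm; rewrite ?undup_uniq // => x.
rewrite !mem_undup; apply/mapP/mapP => [[e]|[d _ ->]].
  rewrite mem_enum => ce ->; exists [ffun q => e (val q)]; first by rewrite mem_enum.
  by apply: Eeps_eval => // q; rewrite ffunE.
(* [d] is extended symmetrically, with [false] at the pairs that neither order places in
   [pair_index]. *)
pose e : {ffun 'I_n * 'I_n -> bool} :=
  [ffun p => if insub p is Some q then d q
             else if insub (p.2, p.1) is Some q then d q else false].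
have ce : sign_choice e.
  apply/forallP => i; apply/forallP => j; rewrite !ffunE /=.
  case: insubP => [q /and3P [/= lt _ _] _|_]; last by case: insubP.
  by rewrite insubF //= ltnNge (ltnW lt).
exists e; first by rewrite mem_enum.
by rewrite (@Eeps_eval _ _ _ _ d) // => q; rewrite ffunE valK.
Qed.

End SignedSum.

Theorem mainTheorem6
    (n : nat) (n_ge4 : (4 <= n)%N)
    (L : closedFieldType) (iota : {rmorphism Tfrac n -> L})
    (L_algebraic : forall x : L, algebraicOver iota x)
    (Rt : 'I_n -> 'I_n -> L)
    (Rt_root : is_root_family iota (first_index n_ge4) Rt)
    (R : realType) :
  exists P : Tpoly n,
    [/\ iota (tofrac P) = normN iota (first_index n_ge4) Rt,
        determinantal_test R (in_minors P)
      & forall A : 'M[R[i]]_n, evalT (cycle_sum A) P = 0].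
Proof.
have root (q : pair_index (first_index n_ge4)) :
    (Rt (fst_of q) (snd_of q)) ^+ 2 = (iota \o (@tofrac _)) (disc q).
  have [lt _ no1 no2] := pair_indexP q; have [_ ->] := Rt_root _ _ no1 no2 lt.
  by rewrite /= /disc /TL !(rmorphB, rmorphM, rmorphXn, rmorph_nat).
have [P [PE PA]] := norm_product_descends (halfE n)
  (@disc_product_nonsquare n (first_index n_ge4)) (signed_sum_poly _) root.
(* The differences of the two 3-cycle products serve as roots of the specialised discriminants, with
   trivial signs. *)
have PT (A : 'M[R[i]]_n) : evalT (cycle_sum A) P = 0.
  apply: (PA _ (evalTm (cycle_sum A)) _ [ffun=> false] _
            (eval_signed_sum_poly_cycle_sum _ A n_ge4)) => q.
  exact: cyclic_difference_sqr.
exists P; split=> // [|A]; first by rewrite normN_values.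
by rewrite eval_in_minors.
Qed.
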